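(* There is an absolute constant $c>0$ such that for every $n\ge 3$ there exists a set $S$ of $n$ points in convex position in the plane such that the number of triangles with vertices in $S$ and area exactly $1$ is at least $c\, n\log n$.
   Context: A triangle spanned by $S$ is an unordered triple of points of $S$. Points are in convex position if each of them is a vertex of the convex hull of the set. *)

(* Defs.v *)
From HB Require Import structures.
From mathcomp Require Import all_boot all_order all_algebra finmap.
From mathcomp Require Import boolp classical_sets interval_inference reals.
From mathcomp Require Import convex exp.

Set Implicit Arguments.
Unset Strict Implicit.
Unset Printing Implicit Defensive.

Import Order.TTheory GRing.Theory Num.Theory.

Local Open Scope classical_set_scope.
Local Open Scope fset_scope.
Local Open Scope ring_scope.
Local Open Scope convex_scope.

Section ConvexPosition.
Context {R : numDomainType} {M : lmodType R}.

Definition convex_hull (A : set M) : set M := smallest (@convex_set R M) A.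

(* The vertices of a convex polygon are its extreme points. *)
Definition vertex (K : set M) (p : M) : Prop :=
  K p /\
  forall (x y : M) (t : {i01 R}), K x -> K y -> 0 < t%:num < 1 ->
    p = (x : convex_lmodType M) <| t |> y -> x = p /\ y = p.

Definition convex_position (S : {fset M}) : Prop :=
  forall p, p \in S -> vertex (convex_hull [set` S]) p.

End ConvexPosition.

Section Triangles.
Context {R : realType}.
Implicit Types (a b c : 'rV[R]_2) (S T : {fset 'rV[R]_2}).

Definition triangle_area a b c : R :=
  `|(b 0 0 - a 0 0) * (c 0 1 - a 0 1) - (c 0 0 - a 0 0) * (b 0 1 - a 0 1)| / 2.

Definition triangles S : {fset {fset 'rV[R]_2}} :=
  [fset T in fpowerset S | #|` T| == 3%N].

(* [triangle_area] is symmetric in its arguments, so the choice of the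
   enumeration a, b, c of T is immaterial. *)
Definition has_area (r : R) T : Prop :=
  exists a b c, T = [fset a; b; c] /\ triangle_area a b c = r.

Definition unit_area_triangles S : {fset {fset 'rV[R]_2}} :=
  [fset T in triangles S | `[< has_area 1 T >]].

End Triangles.

(* Main.v *)
Require Import Defs.
From mathcomp Require Import all_boot all_order all_algebra finmap.
From mathcomp Require Import boolp classical_sets interval_inference.
From mathcomp Require Import unstable reals convex exp.
From mathcomp Require Import ring lra zify.

(** On the parabola [y = x^2] every finite set is in convex position, and the
    triangle with abscissae [x < y < z] has area [(y - x)(z - y)(z - x) / 2],
    which is invariant under translation of the abscissae.  If [a], [b] are
    positive with [a b (a + b) = 2], then replacing a set [A] of reals by the
    union of [A], [A + a] and [A + a + b] copies every unit triangle three
    times and creates the unit triangle [x, x + a, x + a + b] for each [x] in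
    [A].  For [a] large the three translates are disjoint, so [k] such steps
    starting from a point give [3^k] points and [k 3^(k-1)] unit triangles. *)

Set Implicit Arguments.
Unset Strict Implicit.
Unset Printing Implicit Defensive.

Import Order.TTheory GRing.Theory Num.Theory.

Local Open Scope fset_scope.
Local Open Scope ring_scope.
Local Open Scope convex_scope.

(** * Sets of abscissae with many unit triples *)

Section UnitTriples.
Variable R : rcfType.
Implicit Types (A B D : seq R) (t : R * R * R).

Lemma seq_ub (g : R -> R) D :
  (forall d, 0 <= g d) -> exists M, forall d, d \in D -> g d < M.
Proof.
move=> g0; exists (1 + \sum_(d <- D) g d) => d dD.
have : 0 <= \sum_(i <- rem d D) g i by apply: sumr_ge0.
by rewrite (big_rem d dD) /=; lra.
Qed.

(** Pads a set of [3 ^ k] abscissae to exactly [n]: a number above all absolute values in the list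
    is always new. *)
Lemma extend_uniq A n : uniq A -> (size A <= n)%N ->
  exists B, [/\ uniq B, size B = n & {subset A <= B}].
Proof.
move=> uA; elim: n => [|n IHn].
  by rewrite leqn0 size_eq0 => /eqP ->; exists [::].
rewrite leq_eqVlt => /predU1P[sA|/IHn[B [uB sB AB]]]; first by exists A; split.
have [M BM] := @seq_ub Num.norm B (@normr_ge0 _ _).
exists (`|M| :: B); split=> /=; last by move=> x /AB xB; rewrite inE xB orbT.
  rewrite uB andbT; apply/negP => /BM; rewrite normr_id.
  by rewrite ltNge ler_norm.
by rewrite sB.
Qed.

(* [b] is a root of [a X^2 + a^2 X - 2]; as [a] grows, [b < 2 / a^2] becomes
   smaller than every nonzero element of [D] in absolute value. *)
Lemma avoiding_steps D : exists a b,
  [/\ 0 < a /\ 0 < b, a * b * (a + b) = 2 &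
      [/\ a \notin D, b \notin D & a + b \notin D]].
Proof.
have [M DM] : exists M, forall d, d \in D -> `|d| + 2 / `|d| < M.
  by apply: seq_ub => d; rewrite addr_ge0 // divr_ge0.
pose a := 1 + `|M|.
have a1 : 1 <= a by rewrite lerDl.
have Ma : M < a by have := ler_norm M; rewrite /a; lra.
have a0 : 0 < a by lra.
pose s := Num.sqrt (a ^+ 2 + 8 / a).
have s2 : s ^+ 2 = a ^+ 2 + 8 / a.
  by rewrite sqr_sqrtr // addr_ge0 ?sqr_ge0 // divr_ge0 ?ltW.
have sa : a < s.
  rewrite -(@ltr_pXn2r _ 2) ?nnegrE ?sqrtr_ge0 ?(ltW a0) // s2 ltrDl.
  by rewrite divr_gt0.
pose b := (s - a) / 2.
have b0 : 0 < b by rewrite divr_gt0 // subr_gt0.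
have abE : a * b * (a + b) = 2.
  have -> : a * b * (a + b) = a * (s ^+ 2 - a ^+ 2) / 4 by rewrite /b; field.
  by rewrite s2; field; rewrite gt_eqF.
have D_lt d : d \in D -> `|d| < a.
  by move=> /DM dM; have : 0 <= 2 / `|d| by []; lra.
have ND_ge d : a <= d -> d \notin D.
  by move=> ad; apply/negP => /D_lt; have := ler_norm d; lra.
exists a, b; split=> //; split; [exact: ND_ge | | by apply: ND_ge; lra].
(* If [b] were in [D], then [2 / b < a], so [a * b > 2]; but [a * b * (a + b) = 2] with [a + b > 1]
   forces [a * b < 2]. *)
apply/negP => bD; have := DM _ bD; rewrite gtr0_norm // => bM.
have : 2 / b < a by lra.
rewrite ltr_pdivrMr //; have : 0 < a * b by rewrite mulr_gt0.
by nra.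
Qed.

Definition unit_triple A t :=
  let: (x, y, z) := t in
  [/\ [/\ x \in A, y \in A & z \in A], x < y < z &
      (y - x) * (z - y) * (z - x) = 2].

Definition shift_triple (u : R) t := (t.1.1 + u, t.1.2 + u, t.2 + u).

Lemma shift_triple_inj u : injective (shift_triple u).
Proof. by move=> [[x y] z] [[x' y'] z'] [] /addIr -> /addIr -> /addIr ->. Qed.

Lemma unit_triple_shift A B u t :
  (forall x, x \in A -> x + u \in B) ->
  unit_triple A t -> unit_triple B (shift_triple u t).
Proof.
move=> AB; case: t => [[x y] z] [[xA yA zA] xyz e]; split=> /=.
- by split; apply: AB.
- by lra.
- by rewrite -e; ring.
Qed.

Lemma unit_triple_sub A B t :
  {subset A <= B} -> unit_triple A t -> unit_triple B t.
Proof.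
move=> AB; case: t => [[x y] z] [[xA yA zA] xyz e].
by split=> //; split; apply: AB.
Qed.

Lemma triple_step A (Q : seq (R * R * R)) :
  uniq A -> uniq Q -> (forall t, t \in Q -> unit_triple A t) ->
  exists (A' : seq R) (Q' : seq (R * R * R)),
  [/\ uniq A' /\ uniq Q', size A' = (3 * size A)%N,
      size Q' = (3 * size Q + size A)%N &
      forall t, t \in Q' -> unit_triple A' t].
Proof.
move=> uA uQ QA.
(* The shifts [0], [a], [a + b] differ pairwise by [a], [b] or [a + b]. As none of these is a
   difference of elements of [A], the translates are disjoint. *)
have [a [b [[a0 b0] abE [aD bD abD]]]] :=
  avoiding_steps [seq y - x | x <- A, y <- A].
have dis u v : v - u \notin [seq y - x | x <- A, y <- A] ->
    forall x y, x \in A -> y \in A -> x + v = y + u -> False.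
  move=> /negP uvD x y xA yA e; apply: uvD.
  have -> : v - u = y - x by move: e; lra.
  by apply/allpairsP; exists (x, y).
have disa x y : x \in A -> y \in A -> x + a = y -> False.
  by move=> xA yA e; apply: (dis 0 a _ x y) => //; rewrite ?subr0 ?addr0.
have disab x y : x \in A -> y \in A -> x + (a + b) = y -> False.
  by move=> xA yA e; apply: (dis 0 (a + b) _ x y) => //; rewrite ?subr0 ?addr0.
have disb x y : x \in A -> y \in A -> x + (a + b) = y + a -> False.
  by move=> xA yA; apply: dis => //; rewrite addrC addKr.
pose new (x : R) : R * R * R := (x, x + a, x + (a + b)).
pose sh u : seq R := [seq (x + u : R) | x : R <- A].
pose shQ u : seq (R * R * R) := [seq shift_triple u t | t <- Q].
have shI u : uniq (sh u) by rewrite map_inj_uniq //; apply: addIr.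
have shQI u : uniq (shQ u) by rewrite map_inj_uniq //; apply: shift_triple_inj.
exists (A ++ sh a ++ sh (a + b)), (Q ++ shQ a ++ shQ (a + b) ++ map new A).
split.
- split.
    rewrite !cat_uniq uA !shI /= andbT has_cat negb_or -andbA.
    apply/and3P; split; apply/hasPn => _ /mapP[x xA ->].
    + by apply/negP => /(disa _ _ xA)-/(_ erefl).
    + by apply/negP => /(disab _ _ xA)-/(_ erefl).
    + by apply/negP => /mapP[y yA /(disb _ _ xA yA)].
  (* Triples copied into different translates differ in the first entry; a new triple meets all
     three translates, so it is not a copy. *)
  have uN : uniq (map new A) by rewrite map_inj_uniq // => x y [].
  rewrite !cat_uniq uQ !shQI uN /= !has_cat !negb_or andbT -!andbA.
  apply/and5P; split; last (apply/andP; split);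
    apply/hasPn => _ /mapP[t tP ->]; apply/negP.
  + move/QA; case: t tP => [[x y] z] /QA[[xA _ _] _ _] [[xA' _ _] _ _].
    exact: (disa _ _ xA xA').
  + move/QA; case: t tP => [[x y] z] /QA[[xA _ _] _ _] [[xA' _ _] _ _].
    exact: (disab _ _ xA xA').
  + by move/QA => [[_ xA _] _ _]; apply: (disa _ _ tP xA).
  + move=> /mapP[[[x' y'] z'] /QA[[xA' _ _] _ _]].
    case: t tP => [[x y] z] /QA[[xA _ _] _ _] [e _ _].
    exact: (disb _ _ xA xA' e).
  + move=> /mapP[[[x' y'] z'] /QA[[xA' _ _] _ _]] [e _ _].
    by apply: (disa _ _ xA' tP).
  + move=> /mapP[[[x' y'] z'] /QA[[xA' _ _] _ _]] [e _ _].
    by apply: (disab _ _ xA' tP).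
- by rewrite !size_cat !size_map; lia.
- by rewrite !size_cat !size_map; lia.
- move=> t; rewrite !mem_cat => /or4P[/QA|/mapP[{}t /QA tA ->]|
    /mapP[{}t /QA tA ->]|/mapP[x xA ->]].
  + by apply: unit_triple_sub => x xA; rewrite mem_cat xA.
  + apply: (@unit_triple_shift A) => // x xA.
    by rewrite !mem_cat (map_f (fun x => x + a)) ?orbT.
  + apply: (@unit_triple_shift A) => // x xA.
    by rewrite !mem_cat (map_f (fun x => x + (a + b))) ?orbT.
  + split; [split; rewrite !mem_cat | by lra | by rewrite -abE; ring].
    * by rewrite xA.
    * by rewrite (map_f (fun x => x + a)) ?orbT.
    * by rewrite (map_f (fun x => x + (a + b))) ?orbT.
Qed.

(* The count is [k * 3 ^ (k - 1)], written without a truncated predecessor. *)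
Lemma many_unit_triples k : exists A (Q : seq (R * R * R)),
  [/\ uniq A /\ uniq Q, size A = (3 ^ k)%N, (3 * size Q)%N = (k * 3 ^ k)%N &
      forall t, t \in Q -> unit_triple A t].
Proof.
elim: k => [|k [A [Q [[uA uQ] sA sQ QA]]]]; first by exists [:: 0], [::].
have [A' [Q' [u sA' sQ' QA']]] := triple_step uA uQ QA.
exists A', Q'; split=> //; first by rewrite sA' sA expnS.
by rewrite sQ' sA expnS mulnDr sQ; lia.
Qed.

End UnitTriples.

(** * Point sets and triangles on the parabola *)

Section Parabola.
Variable R : realType.
Implicit Types (x y z : R) (B : seq R).

Definition parabola x : 'rV[R]_2 := \row_j x ^+ j.+1.

Lemma parabola0 x : parabola x 0 0 = x.
Proof. by rewrite mxE expr1. Qed.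

Lemma parabola1 x : parabola x 0 1 = x ^+ 2.
Proof. by rewrite mxE. Qed.

Lemma parabola_inj : injective parabola.
Proof. by move=> x y e; rewrite -(parabola0 x) e parabola0. Qed.

(** Twice the signed area is the Vandermonde determinant of the abscissae, which is positive when
    they increase. *)
Lemma parabola_area x y z : x < y < z ->
  triangle_area (parabola x) (parabola y) (parabola z) =
  (y - x) * (z - y) * (z - x) / 2.
Proof.
move=> /andP[xy yz]; rewrite /triangle_area !parabola0 !parabola1.
congr (_ / _); rewrite ger0_norm; first by ring.
have -> : (y - x) * (z ^+ 2 - x ^+ 2) - (z - x) * (y ^+ 2 - x ^+ 2) =
          (y - x) * (z - y) * (z - x) by ring.
by rewrite !mulr_ge0 // subr_ge0; lra.
Qed.

Definition parabola_set B : {fset 'rV[R]_2} := [fset parabola x | x in B].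

(* The tangent at [parabola x] supports the hull and touches it only there:
   [C] is a convex set containing the points, in which [parabola x] is
   extreme. *)
Lemma parabola_set_convex B : convex_position (parabola_set B).
Proof.
move=> _ /imfsetP[x /= xB ->].
(* [L] is the vertical height above the tangent at [parabola x]: it is affine and equals
   [(y - x) ^+ 2] at [parabola y]. *)
pose L (q : 'rV[R]_2) := q 0 1 - 2 * x * q 0 0 + x ^+ 2.
have Lconv (t : {i01 R}) (p q : 'rV[R]_2) :
    L ((p : convex_lmodType 'rV[R]_2) <| t |> q) =
    t%:num * L p + (1 - t%:num) * L q.
  by rewrite /L /conv /= !mxE /onem; ring.
have Lp : L (parabola x) = 0 by rewrite /L parabola0 parabola1; ring.
pose C : set 'rV[R]_2 := [set q | q = parabola x \/ 0 < L q]%classic.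
have L_ge0 q : C q -> 0 <= L q by case=> [->|/ltW]; rewrite ?Lp.
(* With positive weights, an average of nonnegative heights vanishes only if both do, and in [C]
   height zero occurs only at [parabola x]. *)
have extr p q (t : {i01 R}) : C p -> C q -> 0 < t%:num < 1 ->
    L ((p : convex_lmodType 'rV[R]_2) <| t |> q) = 0 ->
    p = parabola x /\ q = parabola x.
  move=> Cp Cq /andP[t0 t1]; rewrite Lconv.
  have := L_ge0 _ Cp; have := L_ge0 _ Cq.
  case: Cp Cq => [->|Lp0] [->|Lq0] //; rewrite ?Lp => ? ? ?; exfalso; nra.
have hullC : (convex_hull [set` parabola_set B] `<=` C)%classic.
  apply: smallest_sub.
    apply/convex_setW => p q /set_mem Cp /set_mem Cq t t0 t1; apply/mem_set.
    have [Le|Ln] := eqVneq (L ((p : convex_lmodType 'rV[R]_2) <| t |> q)) 0.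
      have [|-> ->] := extr p q t Cp Cq _ Le; first by rewrite t0.
      by left; rewrite convmm.
    right; rewrite lt_def Ln Lconv.
    have := L_ge0 _ Cp; have := L_ge0 _ Cq; nra.
  move=> _ /= /imfsetP[y /= yB ->].
  have [->|yx] := eqVneq y x; [by left | right].
  have -> : L (parabola y) = (y - x) ^+ 2.
    by rewrite /L parabola0 parabola1; ring.
  by rewrite exprn_even_gt0 //= subr_eq0.
split; first by apply: sub_gen_smallest; apply/imfsetP; exists x.
move=> p q t /hullC Cp /hullC Cq t01 e; apply: (extr p q t) => //.
by rewrite -e Lp.
Qed.

Definition parabola_triangle (t : R * R * R) : {fset 'rV[R]_2} :=
  [fset parabola t.1.1; parabola t.1.2; parabola t.2].

Lemma mem_parabola_triangle w t :
  (parabola w \in parabola_triangle t) = [|| w == t.1.1, w == t.1.2 | w == t.2].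
Proof. by rewrite !inE !(inj_eq parabola_inj) -orbA. Qed.

(** An increasing triple is recovered from its vertex set: least abscissa, greatest, then the
    remaining one. Hence distinct triples count as distinct triangles. *)
Lemma parabola_triangle_inj x y z x' y' z' : x < y < z -> x' < y' < z' ->
  parabola_triangle (x, y, z) = parabola_triangle (x', y', z') ->
  (x, y, z) = (x', y', z').
Proof.
move=> xyz xyz' /fsetP e.
have sub w : [|| w == x, w == y | w == z] = [|| w == x', w == y' | w == z'].
  by have := e (parabola w); rewrite !mem_parabola_triangle.
have bnd (a b c w : R) :
    a < b < c -> [|| w == a, w == b | w == c] -> a <= w <= c.
  by clear => abc /or3P[] /eqP; lra.
have xx : x = x'.
  have /andP[x'x _] : x' <= x <= z' by apply: (bnd x' y'); rewrite // -sub eqxx.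
  have /andP[xx' _] : x <= x' <= z by apply: (bnd x y); rewrite // sub eqxx.
  by apply/eqP; rewrite eq_le xx'.
have zz : z = z'.
  have /andP[_ zz'] : x' <= z <= z'.
    by apply: (bnd x' y'); rewrite // -sub eqxx !orbT.
  have /andP[_ z'z] : x <= z' <= z.
    by apply: (bnd x y); rewrite // sub eqxx !orbT.
  by apply/eqP; rewrite eq_le zz'.
have /esym := sub y; rewrite -xx -zz eqxx orbT => /or3P[] /eqP yE.
- by move: xyz; rewrite yE ltxx.
- by rewrite yE.
- by move: xyz; rewrite yE ltxx andbF.
Qed.

Lemma unit_triple_triangle B t : unit_triple B t ->
  parabola_triangle t \in unit_area_triangles (parabola_set B).
Proof.
case: t => [[x y] z] [[xB yB zB] xyz e].
rewrite !inE /=; apply/andP; split; last first.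
  apply/asboolP; exists (parabola x), (parabola y), (parabola z); split=> //.
  by rewrite parabola_area // e divff.
apply/andP; split.
  rewrite fpowersetE; apply/fsubsetP => w.
  by rewrite !inE -orbA => /or3P[] /eqP ->; apply: in_imfset.
have /andP[xy yz] := xyz; rewrite /parabola_triangle /=.
rewrite -fsetUA cardfsU1 cardfs2 !inE !(inj_eq parabola_inj).
by rewrite (lt_eqF xy) (lt_eqF yz) (lt_eqF (lt_trans xy yz)).
Qed.

Lemma card_unit_area_triangles B (Q : seq (R * R * R)) :
  uniq Q -> (forall t, t \in Q -> unit_triple B t) ->
  (size Q <= #|` unit_area_triangles (parabola_set B)|)%N.
Proof.
move=> uQ QB.
have <- : #|` [fset parabola_triangle t | t in Q]| = size Q.
  rewrite card_in_imfset /=; first by rewrite undup_id.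
  move=> [[x y] z] [[x' y'] z'] /QB[_ xyz _] /QB[_ xyz' _].
  exact: parabola_triangle_inj.
apply: fsubset_leq_card; apply/fsubsetP => _ /imfsetP[t /= tQ ->].
exact: unit_triple_triangle (QB _ tQ).
Qed.

Lemma card_parabola_set B : uniq B -> #|` parabola_set B| = size B.
Proof.
by move=> uB; rewrite card_imfset /= ?undup_id //; apply: parabola_inj.
Qed.

End Parabola.

(** * The bound for arbitrary [n] *)

Theorem theorem2 (R : realType) :
  exists c : R, 0 < c /\
    forall n : nat, (3 <= n)%N ->
      exists S : {fset 'rV[R]_2},
        [/\ #|` S| = n,
            convex_position S &
            c * (n%:R * ln n%:R) <= (#|` unit_area_triangles S|)%:R].
Proof.
(* The constant combines [ln n <= 4 k] and [n k <= 9 (size Q)], proved below. *)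
exists (1 / 36); split; first by lra.
move=> n n3.
have [k_le k_gt] := andP (@trunc_log_bounds 3 n isT (ltnW (ltnW n3))).
set k := trunc_log 3 n in k_le k_gt.
have k0 : (0 < k)%N by rewrite trunc_log_gt0.
have [A [Q [[uA uQ] sA sQ QA]]] := many_unit_triples R k.
have [B [uB sB AB]] : exists B, [/\ uniq B, size B = n & {subset A <= B}].
  by apply: extend_uniq; rewrite ?sA.
exists (parabola_set B); split.
- by rewrite card_parabola_set.
- exact: parabola_set_convex.
have /card_unit_area_triangles-/(_ uQ) : forall t, t \in Q -> unit_triple B t.
  by move=> t /QA; apply: unit_triple_sub.
rewrite -(ler_nat R); apply: le_trans.
have n0 : (0 : R) < n%:R by rewrite ltr0n (ltn_trans _ n3).
have ln3 : ln (3 : R) <= 2.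
  by rewrite (_ : 3 = 1 + 2); [apply: le_ln1Dx; lra | ring].
(* Since [n < 3 ^ (k + 1)] and [ln 3 <= 2], [ln n <= 2 (k + 1)], which is at most [4 k] because
   [k >= 1]. *)
have lnn : ln (n%:R : R) <= 4 * k%:R.
  apply: (@le_trans _ _ (ln ((3 : R) ^+ k.+1))).
    rewrite ler_ln ?posrE ?exprn_gt0 ?n0 ?ltr0n //.
    by rewrite -natrX ler_nat ltnW.
  rewrite lnXn ?ltr0n // -[ln 3 *+ _]mulr_natr -[k.+1%:R]natr1.
  have k1 : (1 : R) <= k%:R by rewrite ler1n.
  have /ler_wpM2r/(_ _ _ ln3) : (0 : R) <= k%:R + 1 by lra.
  by lra.
(* Here [n k <= 3 * (k * 3 ^ k)], and [k * 3 ^ k] is [3 * size Q]. *)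
have nQ : (n%:R * k%:R : R) <= 9 * (size Q)%:R.
  rewrite -!natrM ler_nat; move: sQ k_gt; rewrite expnS; nia.
by have := ler_wpM2l (ltW n0) lnn; lra.
Qed.
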